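(* For all integers $n\ge 1$: $p(n,1)=1$ and $p(n,2)=\lfloor n/2\rfloor$. For every integer $k\ge 3$ and $n\ge 1$, $$p(n,k)=\sum_{m_k=1}^{\lfloor n/k\rfloor}\ \sum_{m_{k-1}=0}^{\left\lfloor\frac{n-km_k}{k-1}\right\rfloor}\ \sum_{m_{k-2}=0}^{\left\lfloor\frac{n-(k-1)m_{k-1}-km_k}{k-2}\right\rfloor}\cdots\sum_{m_3=0}^{\left\lfloor\frac{n-\sum_{j=4}^{k}jm_j}{3}\right\rfloor}\left\lfloor\frac{2+n-\sum_{j=3}^{k}jm_j}{2}\right\rfloor,$$ i.e. the outermost index $m_k$ runs from $1$ to $\lfloor n/k\rfloor$ and, for $3\le j\le k-1$, the index $m_j$ runs from $0$ to $\left\lfloor\left(n-\sum_{i=j+1}^{k}im_i\right)/j\right\rfloor$ (for $k=3$ there is just the single sum over $m_3$ from $1$ to $\lfloor n/3\rfloor$). Moreover, for every $n\ge 0$, $$p(n)=1+\left\lfloor\frac n2\right\rfloor+\sum_{k=3}^{n}p(n,k),$$ with $p(n,k)$ for $k\ge3$ given by the nested sum above.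
   Context: A partition of a nonnegative integer $n$ is a multiset of positive integers (parts) summing to $n$. $p(n)$ is the number of partitions of $n$ (with $p(0)=1$) and $p(n,k)$ the number of partitions of $n$ into exactly $k$ parts. *)

(* Defs.v *)
From mathcomp Require Import all_boot finmap multiset.
From mathcomp Require Import classical_sets cardinality.

Set Implicit Arguments.
Unset Strict Implicit.
Unset Printing Implicit Defensive.

Local Open Scope fset_scope.
Local Open Scope mset_scope.
Local Open Scope nat_scope.

(* [P : {mset nat}] coerces to the list of its elements with multiplicity, so
   the sum and [size] count repeated parts. *)
Definition is_partition (n : nat) (P : {mset nat}) : bool :=
  (0 \notin P) && (\sum_(i <- P) i == n).

Definition partitions (n : nat) : set {mset nat} :=
  [set P | is_partition n P]%classic.

Definition partitions_in (n k : nat) : set {mset nat} :=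
  [set P | is_partition n P /\ size P = k]%classic.

(* [fset_set] is the empty set on infinite sets; [finite_partitions] and
   [finite_partitions_in] show that this case does not occur. *)
Definition num_partitions (n : nat) : nat := #|` fset_set (partitions n)|.

Definition num_partitions_in (n k : nat) : nat :=
  #|` fset_set (partitions_in n k)|.

(* The sums over m_j, m_(j-1), ..., m_3 with m_k, ..., m_(j+1) already fixed,
   where [s] is the sum of i * m_i for j < i <= k. For j = 2 only the innermost
   summand is left. Each m_i is bounded so that [s <= n], hence the truncated
   subtraction [n - s] is the integer one. *)
Fixpoint inner_sums (n j s : nat) : nat :=
  match j with
  | (_.+2 as j').+1 =>
      \sum_(0 <= m < ((n - s) %/ j).+1) inner_sums n j' (s + j * m)
  | _ => (2 + n - s) %/ 2
  end.

Definition nested_sum (n k : nat) : nat :=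
  \sum_(1 <= m < (n %/ k).+1) inner_sums n k.-1 (k * m).

Lemma finite_partitions (n : nat) : finite_set (partitions n).
Proof.
apply: (@sub_finite_set _ _
  [set seq_mset (map (@nat_of_ord n.+1) (t : seq _)) |
     t in [set: {bseq n of 'I_n.+1}]]%classic); last first.
  by apply: finite_image; exact: finite_finset.
move=> P /andP[P0 /eqP Pn].
have size_le : size [seq (inord i : 'I_n.+1) | i <- (P : seq nat)] <= n.
  rewrite size_map -Pn -sum1_size big_seq [leqRHS]big_seq.
  by apply: leq_sum => -[|i] //; rewrite (negPf P0).
exists (Bseq size_le) => //=.
rewrite -map_comp -[RHS]seq_mset_id; congr seq_mset.
rewrite -[RHS]map_id; apply/eq_in_map => i iP /=.
by rewrite inordK // ltnS -Pn (big_rem i iP) leq_addr.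
Qed.

Lemma finite_partitions_in (n k : nat) : finite_set (partitions_in n k).
Proof.
by apply: sub_finite_set (finite_partitions n) => P [].
Qed.

(* Main.v *)
Require Import Defs.
From mathcomp Require Import all_boot finmap multiset zify.
From mathcomp Require Import classical_sets cardinality.

(** Removing a part 1 from a partition that has one, and subtracting 1 from
    every part of a partition that has none, gives the recurrence
    p(n + k + 1, k + 1) = p(n + k, k) + p(n, k + 1).  Iterating it in the second
    term yields p(n, k + 1) = \sum_(m >= 1) p(n - (k + 1) m + k, k), so each
    level of the nested sum lowers the number of parts by one, down to
    p(r + 2, 2) = (2 + r) %/ 2. *)

Set Implicit Arguments.
Unset Strict Implicit.
Unset Printing Implicit Defensive.

Local Open Scope fset_scope.
Local Open Scope mset_scope.
Local Open Scope nat_scope.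

(** Going through the underlying list keeps multiplicities, and [perm_map_mset] then reduces
    questions about the image to lists. *)
Definition map_mset (K L : choiceType) (f : K -> L) (P : {mset K}) : {mset L} :=
  seq_mset [seq f i | i <- P].

Lemma perm_mset1D (K : choiceType) (a : K) (P : {mset K}) :
  perm_eq (a +` P) (a :: P).
Proof. by rewrite -{1}(seq_mset_id P) -mset_cons perm_eq_seq_mset. Qed.

Lemma perm_map_mset (K L : choiceType) (f : K -> L) (P : {mset K}) :
  perm_eq (map_mset f P) [seq f i | i <- P].
Proof. exact: perm_eq_seq_mset. Qed.

Lemma map_mset_in_can (K L : choiceType) (f : K -> L) (g : L -> K)
    (P : {mset K}) :
  {in P, cancel f g} -> map_mset g (map_mset f P) = P.
Proof.
move=> fK; rewrite -[RHS]seq_mset_id; apply/eq_seq_msetP.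
rewrite (perm_trans (perm_map g (perm_map_mset f P))) // -map_comp.
by have /eq_in_map-> : {in P, g \o f =1 id} by []; rewrite map_id.
Qed.

Lemma is_partition_msetD1 (n : nat) (P : {mset nat}) :
  is_partition n.+1 (1 +` P) = is_partition n P.
Proof.
by rewrite /is_partition in_mset1D (perm_big _ (perm_mset1D _ _)) big_cons.
Qed.

Lemma size_mset1D (K : choiceType) (a : K) (P : {mset K}) :
  size (a +` P) = (size P).+1.
Proof. by rewrite (perm_size (perm_mset1D a P)). Qed.

Lemma size_map_mset (K L : choiceType) (f : K -> L) (P : {mset K}) :
  size (map_mset f P) = size P.
Proof. by rewrite (perm_size (perm_map_mset f P)) size_map. Qed.

Lemma sum_map_succ (P : {mset nat}) :
  \sum_(i <- map_mset succn P) i = \sum_(i <- P) i + size P.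
Proof.
rewrite (perm_big _ (perm_map_mset _ _)) big_map -sum1_size -big_split /=.
by apply: eq_bigr => i _; rewrite addn1.
Qed.

Lemma map_succK : cancel (map_mset succn) (map_mset predn).
Proof. by move=> P; apply: map_mset_in_can. Qed.

(** Since [predn 0] is 0, a part 0 would come back as 1; every positive part is restored. *)
Lemma map_predK (P : {mset nat}) :
  0 \notin P -> map_mset succn (map_mset predn P) = P.
Proof.
by move=> P0; apply: map_mset_in_can => -[|i] //; rewrite (negPf P0).
Qed.

Lemma mem_map_succ (P : {mset nat}) (i : nat) :
  (i.+1 \in map_mset succn P) = (i \in P).
Proof.
by rewrite (perm_mem (perm_map_mset _ _)) mem_map //; exact: succn_inj.
Qed.

Lemma map_succ_pos (P : {mset nat}) : 0 \notin map_mset succn P.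
Proof. by rewrite (perm_mem (perm_map_mset _ _)); apply/mapP => -[]. Qed.

Lemma mem_partitions (n : nat) (P : {mset nat}) :
  (P \in fset_set (partitions n)) = is_partition n P.
Proof.
rewrite in_fset_set; last exact: finite_partitions.
by apply/idP/idP; rewrite inE.
Qed.

Lemma mem_partitions_in (n k : nat) (P : {mset nat}) :
  (P \in fset_set (partitions_in n k)) = is_partition n P && (size P == k).
Proof.
rewrite in_fset_set; last exact: finite_partitions_in.
apply/idP/andP; rewrite inE /partitions_in /=.
  by move=> [-> ->].
by move=> [-> /eqP->].
Qed.

Lemma num_partitions_inS (n k : nat) :
  num_partitions_in (n + k.+1) k.+1
    = num_partitions_in (n + k) k + num_partitions_in n k.+1.
Proof.
(* [A] will be the partitions of n + k + 1 into k + 1 parts that contain 1, and [B] those that do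
   not. *)
pose A := [fset 1 +` P | P in fset_set (partitions_in (n + k) k)].
pose B := [fset map_mset succn P | P in fset_set (partitions_in n k.+1)].
have -> : num_partitions_in (n + k) k = #|` A|.
  rewrite card_imfset //; apply: can_inj (fun P => P `\ 1) _ => P.
  exact: msetD1K.
have -> : num_partitions_in n k.+1 = #|` B|.
  by rewrite card_imfset //; exact: can_inj map_succK.
(* Members of [A] contain 1, whereas a 1 in a member of [B] would come from a part 0. *)
have disjAB : (A `&` B = fset0)%fset.
  apply/eqP/fdisjointP => _ /imfsetP[P _ ->]; apply/imfsetP => -[Q].
  rewrite mem_partitions_in => /andP[/andP[Q0 _] _] eqPQ.
  by move: (mset1D1 1 P); rewrite eqPQ mem_map_succ (negPf Q0).
rewrite -cardfsUI disjAB cardfs0 addn0; congr #|` _|; apply/fsetP => P.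
rewrite inE mem_partitions_in addnS; apply/idP/orP => [|[]].
- move=> /andP[Pn Pk]; have [P1|P1] := boolP (1 \in (P : {mset nat})).
    left; apply/imfsetP; exists (P `\ 1); last by rewrite msetB1K.
    move: Pn Pk; rewrite /= mem_partitions_in -{1 2}(msetB1K P1).
    by rewrite is_partition_msetD1 size_mset1D => ->.
  have /andP[P0 /eqP Psum] := Pn.
  right; apply/imfsetP; exists (map_mset predn P); last by rewrite map_predK.
  rewrite /= mem_partitions_in size_map_mset Pk andbT /is_partition.
  (* A 0 among the predecessors would mean a 1 in [P], which this case excludes. *)
  rewrite -mem_map_succ map_predK // P1 /=.
  move: Psum; rewrite -{1}(map_predK P0) sum_map_succ size_map_mset (eqP Pk).
  by rewrite addnS => -[] /addIn ->.
- move=> /imfsetP[Q /=]; rewrite mem_partitions_in => /andP[Qn /eqP Qk] ->.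
  by rewrite is_partition_msetD1 size_mset1D Qn Qk eqxx.
- move=> /imfsetP[Q /=]; rewrite mem_partitions_in => /andP[/andP[Q0 /eqP Qn]].
  move=> /eqP Qk ->; rewrite /is_partition map_succ_pos sum_map_succ.
  by rewrite size_map_mset Qn Qk addnS !eqxx.
Qed.

Lemma size_partition (n : nat) (P : {mset nat}) :
  is_partition n P -> size P <= n.
Proof.
move=> /andP[P0 /eqP <-]; rewrite -sum1_size big_seq [leqRHS]big_seq.
by apply: leq_sum => -[|i] //; rewrite (negPf P0).
Qed.

Lemma num_partitions_in_gt (n k : nat) : n < k -> num_partitions_in n k = 0.
Proof.
move=> nk; apply/eqP; rewrite cardfs_eq0; apply/eqP/fsetP => P.
rewrite mem_partitions_in inE; apply/negP => /andP[/size_partition Pn /eqP Pk].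
by rewrite -Pk ltnNge Pn in nk.
Qed.

Lemma num_partitions_in0 (n : nat) : num_partitions_in n 0 = (n == 0).
Proof.
have mem0 P : (P \in fset_set (partitions_in n 0)) = (P == mset0) && (n == 0).
  rewrite mem_partitions_in size_mset_eq0 andbC.
  have [->|//] := eqVneq P mset0.
  by rewrite /is_partition in_mset0 big_mset0 eq_sym.
have [n0|n0] := eqVneq n 0.
  have /eqP -> // : num_partitions_in n 0 == 1.
  apply/cardfs1P; exists mset0; apply/fsetP => P.
  by rewrite mem0 n0 eqxx andbT inE.
apply/eqP; rewrite cardfs_eq0; apply/eqP/fsetP => P.
by rewrite mem0 (negPf n0) andbF inE.
Qed.

Lemma num_partitions_in1 (n : nat) : num_partitions_in n.+1 1 = 1.
Proof.
elim: n => [|n IHn]; rewrite -[X in num_partitions_in X](addn1 _).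
  by rewrite num_partitions_inS num_partitions_in0 num_partitions_in_gt.
by rewrite num_partitions_inS num_partitions_in0 IHn addn0.
Qed.

(** The recurrence at k = 1 reads p(n + 2, 2) = 1 + p(n, 2), starting from p(0, 2) = p(1, 2) = 0. *)
Lemma num_partitions_in2 (n : nat) : num_partitions_in n 2 = n %/ 2.
Proof.
elim/ltn_ind: n => -[|[|n]] IHn; try by rewrite num_partitions_in_gt.
rewrite -(addn2 n) num_partitions_inS addn1 num_partitions_in1 IHn; lia.
Qed.

(** Strong induction in steps of k + 1: the recurrence splits off the term m = 1, and the hypothesis
    at n - (k + 1) gives the others with m shifted by one. For n < k + 1 both sides are 0. *)
Lemma num_partitions_in_sum (n k : nat) :
  num_partitions_in n k.+1
    = \sum_(1 <= m < (n %/ k.+1).+1) num_partitions_in (n - k.+1 * m + k) k.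
Proof.
elim/ltn_ind: n => n IHn; have [nk|kn] := ltnP n k.+1.
  by rewrite divn_small // num_partitions_in_gt // big_geq.
rewrite -{1}(subnK kn) num_partitions_inS IHn; last lia.
have -> : n %/ k.+1 = ((n - k.+1) %/ k.+1).+1.
  by rewrite -{1}(subnK kn) divnDr // divnn addn1.
rewrite [RHS]big_ltn // muln1.
congr (_ + _); rewrite [RHS]big_add1 /=.
apply: eq_bigr => m _ /=; congr (num_partitions_in (_ + k) k); lia.
Qed.

(** Adding j + 2 to the remainder n - s accounts for the inner indices starting at 0: replacing m by
    m + 1 in [num_partitions_in_sum] turns its range, which starts at 1, into that of
    [inner_sums]. *)
Lemma inner_sumsE (n j s : nat) :
  s <= n -> inner_sums n j.+2 s = num_partitions_in (n - s + j.+2) j.+2.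
Proof.
elim: j s => [|j IHj] s sn.
  by rewrite num_partitions_in2 /=; congr (_ %/ 2); lia.
rewrite num_partitions_in_sum divnDr // divnn /= big_add1 /= addn1.
rewrite !big_mkord; apply: eq_bigr => m _.
(* The range of m keeps the new partial sum at most n, as the induction hypothesis requires. *)
have mr : j.+3 * m <= n - s by rewrite mulnC -leq_divRL // -ltnS ltn_ord.
rewrite -[LHS]/(inner_sums n j.+2 (s + j.+3 * m)) IHj; last lia.
congr num_partitions_in; lia.
Qed.

(** The outermost index already starts at 1, so [num_partitions_in_sum] applies without
    reindexing. *)
Lemma nested_sumE (n k : nat) :
  nested_sum n k.+3 = num_partitions_in n k.+3.
Proof.
rewrite num_partitions_in_sum /nested_sum; apply: eq_big_nat => m /andP[_ mn].
by rewrite inner_sumsE // mulnC -leq_divRL.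
Qed.

(** Double counting: after exchanging the sums, each partition contributes 1 at the single index k
    equal to its size, which is in range by [size_partition]. *)
Lemma num_partitionsE (n : nat) :
  num_partitions n = \sum_(0 <= k < n.+1) num_partitions_in n k.
Proof.
rewrite /num_partitions card_fset_sum1.
under eq_big_nat => k _.
  rewrite /num_partitions_in card_fset_sum1.
  have -> : fset_set (partitions_in n k)
    = [fset P in fset_set (partitions n) | size (P : {mset nat}) == k].
    by apply/fsetP => P; rewrite mem_partitions_in !inE /= mem_partitions.
  rewrite -big_fset_condE big_mkcond /=.
over.
rewrite exchange_big /=; apply: eq_big_seq => P.
rewrite mem_partitions => /size_partition Pn.
by rewrite big_mkord -big_mkcond (big_pred1 (Ordinal (Pn : _ < n.+1))).
Qed.

Theorem theorem3 :
  (forall n : nat, 1 <= n ->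
     num_partitions_in n 1 = 1 /\ num_partitions_in n 2 = n %/ 2) /\
  (forall k n : nat, 3 <= k -> 1 <= n ->
     num_partitions_in n k = nested_sum n k) /\
  (forall n : nat,
     num_partitions n
       = 1 + n %/ 2 + \sum_(3 <= k < n.+1) num_partitions_in n k /\
     num_partitions n
       = 1 + n %/ 2 + \sum_(3 <= k < n.+1) nested_sum n k).
Proof.
have total n : num_partitions n
    = 1 + n %/ 2 + \sum_(3 <= k < n.+1) num_partitions_in n k.
  (* For n < 2 the sum over k is too short to split off k = 0, 1, 2. The summand 1 is p(0, 0) when n
     = 0 and p(n, 1) otherwise. *)
  rewrite num_partitionsE; case: n => [|[|n]].
  - by rewrite big_nat1 num_partitions_in0 big_geq.
  - rewrite big_nat_recl // big_nat1 num_partitions_in0 num_partitions_in1.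
    by rewrite big_geq.
  rewrite big_ltn // big_ltn // big_ltn // num_partitions_in0.
  by rewrite num_partitions_in1 num_partitions_in2 addnA.
split=> [[|n] // _|]; first by rewrite num_partitions_in1 num_partitions_in2.
split=> [[|[|[|k]]] // n _ _|n]; first by rewrite nested_sumE.
split; rewrite total //; congr (_ + _); apply: eq_big_nat => -[|[|[|k]]] // _.
by rewrite nested_sumE.
Qed.
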